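(* Let $\alpha,\beta>0$ and let $M_L$ ($L\ge 1$) be the $2^L\times 2^L$ Markov matrix of the asymmetric annihilation process on $L$ sites (defined in the context). Define $2^{L+1}\times 2^L$ matrices $T_{L,L+1}$, $L\ge 1$, written in blocks of size $2^L\times 2^L$ as $$T_{L,L+1}=\begin{pmatrix}T_1^{(L)}\\ T_2^{(L)}\end{pmatrix},$$ recursively by the initial condition $$T_{1,2}=\begin{pmatrix}1+\beta+\alpha\beta & \alpha+\beta+\alpha\beta\\ \alpha & 1\\ \alpha+\alpha\beta & \alpha\beta\\ 0&\alpha\end{pmatrix}$$ and, for $L\ge 2$, $$T_1^{(L)}=\begin{pmatrix} T_1^{(L-1)}+\frac1\alpha T_2^{(L-1)} & 2T_2^{(L-1)}+\frac1\alpha T_2^{(L-1)}(\sigma\otimes \mathbb{1}_{L-2})\\[2pt] T_2^{(L-1)} & \frac1\alpha T_2^{(L-1)}\end{pmatrix},\qquad T_2^{(L)}=\begin{pmatrix}2T_2^{(L-1)} & T_2^{(L-1)}(\sigma\otimes \mathbb{1}_{L-2})\\[2pt] 0& T_2^{(L-1)}\end{pmatrix}.$$ Then $(T_{L,L+1})_{L\ge1}$ is a family of transfer matrices for the model, i.e. for every $L\ge 1$ $$M_{L+1}T_{L,L+1}=T_{L,L+1}M_L\qquad\text{and}\qquad M_{L+1}T_{L,L+1}\neq 0 .$$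
   Context: The model: a continuous-time Markov chain on configurations $\eta=(\eta_1,\dots,\eta_L)\in\{0,1\}^L$ ($1$ = occupied, $0$ = empty), with parameters $\alpha,\beta>0$ and the following transitions. Bulk: for each pair of neighbouring sites $(i,i+1)$, $1\le i\le L-1$, $10\to 01$ with rate $1$ and $11\to 00$ with rate $1$. Left boundary: at site $1$, $0\to 1$ with rate $\alpha$ and $1\to 0$ with rate $\alpha$. Right boundary: at site $L$, $1\to0$ with rate $\beta$. The Markov matrix $M_L$ has rows and columns indexed by the $2^L$ binary words of length $L$ in increasing order (from $00\cdots0$ to $11\cdots 1$, first site most significant); for $i\ne j$ its $(i,j)$ entry is the total rate of the transition from the $j$-th configuration to the $i$-th configuration, and the diagonal entries are such that every column sums to $0$. For example $M_1=\begin{pmatrix}-\alpha&\alpha+\beta\\ \alpha&-\alpha-\beta\end{pmatrix}$. Notation: $\sigma=\begin{pmatrix}0&1\\1&0\end{pmatrix}$; $\mathbb{1}_K$ is the identity matrix of size $2^K$ (so $\mathbb{1}_0=(1)$); $\otimes$ is the Kronecker product. A family of transfer matrices for $\{M_L\}$ means matrices $T_{L,L+1}$ of size $2^{L+1}\times2^L$ with $M_{L+1}T_{L,L+1}=T_{L,L+1}M_L$ and $M_{L+1}T_{L,L+1}\ne0$ for all $L$. *)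

(* Defs.v *)
From mathcomp Require Import all_boot all_order all_algebra.
From mathcomp Require Import mxtens.

Set Implicit Arguments.
Unset Strict Implicit.
Unset Printing Implicit Defensive.

Import Order.TTheory GRing.Theory Num.Theory.
Local Open Scope ring_scope.

(* [true] is an occupied site. Sites are numbered from 0, so site k here is
   site k + 1 in the usual numbering 1, ..., L. *)
Definition config (L : nat) := {ffun 'I_L -> bool}.

(* The binary word of length L whose value is i, first site most significant. *)
Definition word (L : nat) (i : 'I_(2 ^ L)) : config L :=
  [ffun k : 'I_L => odd (i %/ 2 ^ (L - k.+1))].

Definition eq_off (L : nat) (A : {set 'I_L}) (x y : config L) : bool :=
  [forall k, (k \notin A) ==> (x k == y k)].

(* y is obtained from x by replacing the local state a at site i by b. *)
Definition step1 (L : nat) (i : 'I_L) (a b : bool) (x y : config L) : bool :=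
  [&& eq_off [set i] x y, x i == a & y i == b].

Definition step2 (L : nat) (i j : 'I_L) (a b : bool * bool)
    (x y : config L) : bool :=
  [&& eq_off [set i; j] x y, (x i, x j) == a & (y i, y j) == b].

Definition bulk_rate (R : realFieldType) (L : nat) (x y : config L) : R :=
  \sum_(i < L) \sum_(j < L | j == i.+1 :> nat)
     ((step2 i j (true, false) (false, true) x y)%:R
      + (step2 i j (true, true) (false, false) x y)%:R).

Definition left_rate (R : realFieldType) (alpha : R) (L : nat)
    (x y : config L) : R :=
  \sum_(i < L | i == 0%N :> nat)
     (alpha * (step1 i false true x y)%:R
      + alpha * (step1 i true false x y)%:R).

Definition right_rate (R : realFieldType) (beta : R) (L : nat)
    (x y : config L) : R :=
  \sum_(i < L | i.+1 == L) beta * (step1 i true false x y)%:R.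

(* Total rate of the transition from x to y; meaningful for x != y. *)
Definition rate (R : realFieldType) (alpha beta : R) (L : nat)
    (x y : config L) : R :=
  bulk_rate R x y + left_rate alpha x y + right_rate beta x y.

(* Columns are indexed by the source configuration, rows by the target. *)
Definition markov_matrix (R : realFieldType) (alpha beta : R) (L : nat) :
    'M[R]_(2 ^ L) :=
  \matrix_(i, j)
    if i == j then - \sum_(k | k != j) rate alpha beta (word j) (word k)
    else rate alpha beta (word j) (word i).

Definition mx2 (R : realFieldType) (a b c d : R) : 'M[R]_2 :=
  \matrix_(i, j) if i == 0 then (if j == 0 then a else b)
                 else (if j == 0 then c else d).

Definition sigma (R : realFieldType) : 'M[R]_2 := mx2 0 1 1 0.

Lemma pow2D (n : nat) : (2 ^ n + 2 ^ n = 2 ^ n.+1)%N.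
Proof. by rewrite addnn -mul2n expnS. Qed.

Lemma pow2M (n : nat) : (2 * 2 ^ n = 2 ^ n.+1)%N.
Proof. by rewrite expnS. Qed.

Definition block2 (R : realFieldType) (n : nat) (A B C D : 'M[R]_(2 ^ n)) :
    'M[R]_(2 ^ n.+1) :=
  castmx (pow2D n, pow2D n) (block_mx A B C D).

(* sigma (x) 1_n, where 1_n is the identity matrix of size 2 ^ n. *)
Definition sigma_tens (R : realFieldType) (n : nat) : 'M[R]_(2 ^ n.+1) :=
  castmx (pow2M n, pow2M n) (tensmx (sigma R) (1%:M : 'M[R]_(2 ^ n))).

(* T_blocks alpha beta n is the pair (T_1^(L), T_2^(L)) for L = n + 1. *)
Fixpoint T_blocks (R : realFieldType) (alpha beta : R) (n : nat) :
    'M[R]_(2 ^ n.+1) * 'M[R]_(2 ^ n.+1) :=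
  match n with
  | 0 =>
      (mx2 (1 + beta + alpha * beta) (alpha + beta + alpha * beta)
           alpha                     1,
       mx2 (alpha + alpha * beta) (alpha * beta)
           0                      alpha)
  | m.+1 =>
      let: (T1, T2) := T_blocks alpha beta m in
      (block2 (T1 + alpha^-1 *: T2)
              (2 *: T2 + alpha^-1 *: (T2 *m sigma_tens R m))
              T2
              (alpha^-1 *: T2),
       block2 (2 *: T2) (T2 *m sigma_tens R m)
              0         T2)
  end.

(* T_{L,L+1}; the value at L = 0 is a dummy. *)
Definition transfer_matrix (R : realFieldType) (alpha beta : R) (L : nat) :
    'M[R]_(2 ^ L.+1, 2 ^ L) :=
  match L with
  | 0 => 0
  | n.+1 =>
      let: (T1, T2) := T_blocks alpha beta n in
      castmx (pow2D n.+1, erefl) (col_mx T1 T2)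
  end.

Definition transfer_matrix_family (R : realFieldType)
    (M : forall L : nat, 'M[R]_(2 ^ L))
    (T : forall L : nat, 'M[R]_(2 ^ L.+1, 2 ^ L)) : Prop :=
  forall L : nat, (1 <= L)%N ->
    M L.+1 *m T L = T L *m M L /\ M L.+1 *m T L <> 0.

(* Main.v *)
(* Let S = sigma (x) 1 act on the first site of L sites and N = M_L - alpha S.
   Splitting off the first site,
     M_{L+1} = [N, S + alpha; alpha, N - 1].
   The transfer matrix satisfies T_1 = T_2 (S + 1 / alpha), N T_2 = T_2 N and
   S T_2 = T_2 (S + S N - N S).  The last identity at L + 1 only uses S^2 = 1,
   at L it gives the commutation of T_2 and N at L + 1, and the three together
   are the intertwining relation.  For nonvanishing, the lower left block of
   T_2 M_L is alpha times the matrix T_2 for L - 1 sites. *)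
Require Import Defs.
From mathcomp Require Import all_boot all_order all_algebra.
From mathcomp Require Import mxtens ring.

Import Order.TTheory GRing.Theory Num.Theory.
Local Open Scope ring_scope.

(** * Splitting off the first site of a configuration *)

Section Configurations.

Definition behead_config {n} (x : config n.+1) : config n :=
  [ffun k => x (lift ord0 k)].

(** These pairs are the nonzero entries of [sigma_tens], as [sigma_tens_word] shows. *)
Definition flip_head {n} (x y : config n.+1) : bool :=
  (x ord0 != y ord0) && (behead_config x == behead_config y).

Lemma config_eqE {n} (x y : config n.+1) :
  (x == y) = (x ord0 == y ord0) && (behead_config x == behead_config y).
Proof.
apply/eqP/andP => [-> // | [/eqP xy0 /eqP xy]].
apply/ffunP => i; case: (unliftP ord0 i) => [j|] -> //.
by have /ffunP/(_ j) := xy; rewrite !ffunE.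
Qed.

Lemma eq_off0 {n} (x y : config n) : eq_off set0 x y = (x == y).
Proof.
apply/forallP/eqP => [xy | -> k]; last by rewrite eqxx implybT.
by apply/ffunP => k; have := xy k; rewrite inE => /eqP.
Qed.

Lemma eq_offS {n} (A : {set 'I_n.+1}) (x y : config n.+1) :
  eq_off A x y = ((ord0 \in A) || (x ord0 == y ord0))
    && eq_off (lift ord0 @^-1: A) (behead_config x) (behead_config y).
Proof.
apply/forallP/andP => [xy | [xy0 /forallP xy] i].
  split; first by have := xy ord0; rewrite implyNb.
  by apply/forallP => k; have := xy (lift ord0 k); rewrite !ffunE inE.
case: (unliftP ord0 i) => [j|] ->; last by rewrite implyNb.
by have := xy j; rewrite !ffunE inE.
Qed.

Lemma preim_lift_set1_0 n : lift ord0 @^-1: [set ord0 : 'I_n.+1] = set0.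
Proof. by apply/setP => k; rewrite !inE. Qed.

Lemma preim_lift_set1 n (i : 'I_n) :
  lift ord0 @^-1: [set lift ord0 i] = [set i].
Proof. by apply/setP => k; rewrite !inE (inj_eq lift_inj). Qed.

Lemma step1_head {n} a b (x y : config n.+1) :
  step1 ord0 a b x y = [&& behead_config x == behead_config y,
                           x ord0 == a & y ord0 == b].
Proof. by rewrite /step1 eq_offS preim_lift_set1_0 eq_off0 inE eqxx. Qed.

Lemma step1_lift {n} (i : 'I_n) a b (x y : config n.+1) :
  step1 (lift ord0 i) a b x y =
  (x ord0 == y ord0) && step1 i a b (behead_config x) (behead_config y).
Proof. by rewrite /step1 eq_offS preim_lift_set1 inE !ffunE -andbA. Qed.

Lemma step2_lift {n} (i j : 'I_n) a b (x y : config n.+1) :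
  step2 (lift ord0 i) (lift ord0 j) a b x y =
  (x ord0 == y ord0) && step2 i j a b (behead_config x) (behead_config y).
Proof.
by rewrite /step2 eq_offS preimsetU !preim_lift_set1 !inE !ffunE -andbA.
Qed.

Lemma step2_head {n} a b (x y : config n.+2) :
  step2 ord0 (lift ord0 ord0) a b x y =
  [&& x ord0 == a.1, y ord0 == b.1 &
      step1 ord0 a.2 b.2 (behead_config x) (behead_config y)].
Proof.
case: a b => [a1 a2] [b1 b2].
rewrite /step2 /step1 eq_offS preimsetU preim_lift_set1_0 preim_lift_set1.
rewrite set0U !inE !ffunE !xpair_eqE /=.
by case: (x ord0 == a1) (y ord0 == b1) => [] []; rewrite /= ?andbF.
Qed.

End Configurations.

(** * Recursion of the transition rates in the number of sites *)

Section Rates.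
Context {R : realFieldType} (alpha beta : R).

(** Creation and annihilation at the left end share the rate [alpha], so the boundary acts as a
    symmetric flip. *)
Lemma left_rateE n (x y : config n.+1) :
  left_rate alpha x y = alpha * (flip_head x y)%:R.
Proof.
rewrite /left_rate big_mkcond big_ord_recl big1 //= addr0 !step1_head /flip_head.
by case: (x ord0) (y ord0) (behead_config x == _) => [] [] []; rewrite /= ?(mulr0, addr0, add0r).
Qed.

Lemma right_rateS n (x y : config n.+2) :
  right_rate beta x y = (x ord0 == y ord0)%:R *
    right_rate beta (behead_config x) (behead_config y).
Proof.
rewrite /right_rate big_mkcond big_ord_recl /= add0r -big_mkcond /= mulr_sumr.
apply: eq_big => // i _.
by rewrite step1_lift -mulnb natrM mulrCA.
Qed.

(** Both bulk moves on the first bond, 10 to 01 and 11 to 00, empty the first site and flip the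
    second, whatever the state of the second. *)
Lemma bulk_rateS n (x y : config n.+2) :
  bulk_rate R x y = (x ord0 == y ord0)%:R *
    bulk_rate R (behead_config x) (behead_config y)
    + (x ord0 && ~~ y ord0)%:R * (flip_head (behead_config x) (behead_config y))%:R.
Proof.
rewrite /bulk_rate big_ord_recl addrC; congr (_ + _).
  rewrite mulr_sumr; apply: eq_bigr => i _.
  rewrite big_mkcond big_ord_recl /= add0r -big_mkcond /= mulr_sumr.
  apply: eq_big => // j _.
  by rewrite !step2_lift -!mulnb !natrM mulrDr.
rewrite big_mkcond big_ord_recl /= add0r big_ord_recl /= big1 // addr0.
rewrite !step2_head /= !step1_head /flip_head.
by case: (x ord0) (y ord0) (behead_config x ord0) (behead_config y ord0)
   (_ == behead_config (behead_config y)) => [] [] [] [] [];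
   rewrite /= ?(mulr0, mul0r, mulr1, addr0, add0r).
Qed.

(** The subtracted term removes the left boundary flip from the rate of the tail, whose first site
    is now an inner site. *)
Lemma rateS n (x y : config n.+2) :
  rate alpha beta x y =
    (x ord0 == y ord0)%:R * (rate alpha beta (behead_config x) (behead_config y)
        - alpha * (flip_head (behead_config x) (behead_config y))%:R)
    + (x ord0 && ~~ y ord0)%:R * (flip_head (behead_config x) (behead_config y))%:R
    + alpha * (flip_head x y)%:R.
Proof. by rewrite /rate bulk_rateS right_rateS !left_rateE; ring. Qed.

End Rates.

(** * Binary words and their leading bit *)

Section Words.

(** Built with the same cast as [block2], so that the leading bit selects the block. *)
Definition cons_index {n} (b : bool) (r : 'I_(2 ^ n)) : 'I_(2 ^ n.+1) :=
  cast_ord (pow2D n) (if b then rshift (2 ^ n) r else lshift (2 ^ n) r).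

Lemma val_cons_index {n} b (r : 'I_(2 ^ n)) :
  cons_index b r = (b * 2 ^ n + r)%N :> nat.
Proof. by case: b => /=; rewrite ?mul1n. Qed.

Lemma cons_indexP {n} (i : 'I_(2 ^ n.+1)) : exists b r, i = @cons_index n b r.
Proof.
have [j ->] : exists j, i = cast_ord (pow2D n) j.
  by exists (cast_ord (esym (pow2D n)) i); rewrite cast_ordKV.
by case: (split_ordP j) => r ->; [exists false | exists true]; exists r.
Qed.

Lemma cons_index_eq {n} b c (r s : 'I_(2 ^ n)) :
  (cons_index b r == cons_index c s) = (b == c) && (r == s).
Proof.
rewrite (inj_eq (@cast_ord_inj _ _ _)).
by case: b c => [] []; rewrite ?eq_rshift ?eq_lshift ?eq_rlshift ?eq_lrshift.
Qed.

Lemma word_head {n} b (r : 'I_(2 ^ n)) : word (cons_index b r) ord0 = b.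
Proof.
rewrite ffunE val_cons_index subn1 /= divnMDl ?expn_gt0 //.
by rewrite divn_small // addn0; case: b.
Qed.

Lemma word_behead {n} b (r : 'I_(2 ^ n)) :
  behead_config (word (cons_index b r)) = word r.
Proof.
apply/ffunP => k; rewrite !ffunE val_cons_index /= /bump /= add1n subSS.
(* The leading bit adds a multiple of [2 ^ k.+1] to the quotient, which leaves its parity
   unchanged. *)
have {1}-> : (2 ^ n = 2 ^ k.+1 * 2 ^ (n - k.+1))%N by rewrite -expnD subnKC.
by rewrite mulnA divnMDl ?expn_gt0 // oddD oddM oddX /= andbF.
Qed.

Lemma word_eq {n} (r s : 'I_(2 ^ n)) : (word r == word s) = (r == s).
Proof.
elim: n r s => [|n IH] r s.
  have -> : r = s by apply: val_inj; case: r s => [[|r] ?] [[|s] ?].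
  by rewrite !eqxx.
have [b [i ->]] := cons_indexP r; have [c [j ->]] := cons_indexP s.
by rewrite config_eqE !word_head !word_behead IH cons_index_eq.
Qed.

Lemma flip_head_word {n} b c (r s : 'I_(2 ^ n)) :
  flip_head (word (cons_index b r)) (word (cons_index c s)) =
  (b != c) && (r == s).
Proof. by rewrite /flip_head !word_head !word_behead word_eq. Qed.

End Words.

(** * Calculus of two by two block matrices *)

Section Blocks.
Context {R : realFieldType}.

(* [mxE] restricted to the linear operations, so that entries of products stay
   atomic. *)
Lemma mx_linE m p (i : 'I_m) (j : 'I_p) :
  (forall A B : 'M[R]_(m, p), (A + B) i j = A i j + B i j) *
  (forall A : 'M[R]_(m, p), (- A) i j = - A i j) *
  (forall a (A : 'M[R]_(m, p)), (a *: A) i j = a * A i j) *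
  ((0 : 'M[R]_(m, p)) i j = 0).
Proof. by split; [split; [split|]|] => *; rewrite mxE. Qed.

Lemma castmx_eq0 m p m' p' (eq_mp : (m = m') * (p = p')) (A : 'M[R]_(m, p)) :
  (castmx eq_mp A == 0) = (A == 0).
Proof. by case: eq_mp => eq_m eq_p; case: _ / eq_m; case: _ / eq_p; rewrite castmx_id. Qed.

Section Size.
Context {n : nat}.
Implicit Types (A B C D : 'M[R]_(2 ^ n)).

Lemma block2E A B C D b c r s :
  block2 A B C D (cons_index b r) (cons_index c s) =
  (if b then (if c then D else C) else (if c then B else A)) r s.
Proof.
rewrite castmxE !cast_ordK.
by case: b c => [] []; rewrite ?(block_mxEul, block_mxEur, block_mxEdl, block_mxEdr).
Qed.

Lemma block2P (X Y : 'M[R]_(2 ^ n.+1)) :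
  (forall b c r s, X (cons_index b r) (cons_index c s) =
                   Y (cons_index b r) (cons_index c s)) -> X = Y.
Proof.
move=> XY; apply/matrixP => i j.
by have [b [r ->]] := cons_indexP i; have [c [s ->]] := cons_indexP j.
Qed.

Lemma sum_cons_index (F : 'I_(2 ^ n.+1) -> R) :
  \sum_k F k = \sum_r F (cons_index false r) + \sum_r F (cons_index true r).
Proof.
rewrite (reindex (cast_ord (pow2D n))) ?big_split_ord //=.
by apply: onW_bij; exists (cast_ord (esym (pow2D n))) => i;
  rewrite ?cast_ordK ?cast_ordKV.
Qed.

Lemma mul_block2 A B C D A' B' C' D' :
  block2 A B C D *m block2 A' B' C' D' =
  block2 (A *m A' + B *m C') (A *m B' + B *m D')
         (C *m A' + D *m C') (C *m B' + D *m D').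
Proof.
apply: block2P => b c r s; rewrite mxE sum_cons_index block2E.
under eq_bigr do rewrite !block2E.
under [X in _ + X]eq_bigr do rewrite !block2E.
by case: b c => [] []; rewrite !mxE.
Qed.

Lemma add_block2 A B C D A' B' C' D' :
  block2 A B C D + block2 A' B' C' D' =
  block2 (A + A') (B + B') (C + C') (D + D').
Proof.
by apply: block2P => b c r s; rewrite mxE !block2E; case: b c => [] []; rewrite !mxE.
Qed.

Lemma scale_block2 a A B C D :
  a *: block2 A B C D = block2 (a *: A) (a *: B) (a *: C) (a *: D).
Proof.
by apply: block2P => b c r s; rewrite mxE !block2E; case: b c => [] []; rewrite !mxE.
Qed.

Lemma sub_block2 A B C D A' B' C' D' :
  block2 A B C D - block2 A' B' C' D' =
  block2 (A - A') (B - B') (C - C') (D - D').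
Proof. by rewrite -scaleN1r scale_block2 add_block2 !scaleN1r. Qed.

Lemma scalar_block2 a : a%:M = block2 a%:M 0 0 a%:M :> 'M[R]_(2 ^ n.+1).
Proof.
by apply: block2P => b c r s; rewrite !block2E !mxE cons_index_eq;
  case: b c => [] []; rewrite !mxE.
Qed.

Lemma block2_eq0 A B C D :
  block2 A B C D = 0 -> [/\ A = 0, B = 0, C = 0 & D = 0].
Proof.
move=> /matrixP ABCD0; split; apply/matrixP => r s;
  [have := ABCD0 (cons_index false r) (cons_index false s)
  |have := ABCD0 (cons_index false r) (cons_index true s)
  |have := ABCD0 (cons_index true r) (cons_index false s)
  |have := ABCD0 (cons_index true r) (cons_index true s)];
  by rewrite block2E !mxE.
Qed.

Lemma mul_block2_col m (A B C D : 'M[R]_(2 ^ n)) (T1 T2 : 'M[R]_(2 ^ n, m)) :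
  block2 A B C D *m castmx (pow2D n, erefl) (col_mx T1 T2) =
  castmx (pow2D n, erefl) (col_mx (A *m T1 + B *m T2) (C *m T1 + D *m T2)).
Proof. by rewrite -mul_block_col /block2; case: _ / (pow2D n); rewrite !castmx_id. Qed.

Lemma sigma_tensE : sigma_tens R n = block2 0 1%:M 1%:M 0.
Proof.
(* The product index of the Kronecker product and the sum index of the block matrix both have the
   value [b * 2 ^ n + r]. *)
have castE b (r : 'I_(2 ^ n)) : cast_ord (esym (pow2M n)) (cons_index b r) =
    mxtens_index ((if b then ord_max else ord0) : 'I_2, r).
  by apply: val_inj; rewrite [LHS](val_cons_index b r); case: b.
apply: block2P => b c r s; rewrite block2E castmxE !castE tensmxE.
by case: b c => [] []; rewrite !mxE /= ?mul0r ?mul1r.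
Qed.

End Size.

Lemma sigma_tens_mulK n : sigma_tens R n *m sigma_tens R n = 1%:M.
Proof.
by rewrite sigma_tensE mul_block2 !mul0mx !mulmx0 !mul1mx !addr0 !add0r
  -scalar_block2.
Qed.

Lemma sigma_tens_word n (i j : 'I_(2 ^ n.+1)) :
  sigma_tens R n i j = (flip_head (word j) (word i))%:R.
Proof.
have [b [r ->]] := cons_indexP i; have [c [s ->]] := cons_indexP j.
rewrite sigma_tensE block2E flip_head_word eq_sym.
by case: b c => [] []; rewrite !mxE // eq_sym.
Qed.

End Blocks.

(** * Block form of the Markov matrix *)

Section Generator.
Context {R : realFieldType} (alpha beta : R).

(** The sum may include [k = j]: on the diagonal, the rate from [j] to itself cancels against the
    first term. *)
Lemma markov_matrixE L (i j : 'I_(2 ^ L)) :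
  markov_matrix alpha beta L i j = rate alpha beta (word j) (word i)
    - (i == j)%:R * \sum_k rate alpha beta (word j) (word k).
Proof.
rewrite mxE; case: eqVneq => [->|_]; last by rewrite mul0r subr0.
by rewrite [in RHS](bigD1 j) //= mul1r opprD addNKr.
Qed.

Lemma sum_sigma_tens n (j : 'I_(2 ^ n.+1)) : \sum_i sigma_tens R n i j = 1.
Proof.
have [c [s ->]] := cons_indexP j; rewrite sum_cons_index sigma_tensE.
under eq_bigr do rewrite block2E.
under [X in _ + X]eq_bigr do rewrite block2E.
have sum1 : \sum_r (1%:M : 'M[R]_(2 ^ n)) r s = 1.
  by rewrite (bigD1 s) //= big1 => [|i /negPf si]; rewrite mxE ?eqxx ?addr0 ?si.
have sum0 : \sum_r (0 : 'M[R]_(2 ^ n)) r s = 0.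
  by rewrite big1 // => i _; rewrite mxE.
by case: c; rewrite sum1 sum0 ?addr0 ?add0r.
Qed.

Lemma rate_cons n b c (r s : 'I_(2 ^ n.+1)) :
  rate alpha beta (word (cons_index c s)) (word (cons_index b r)) =
  (c == b)%:R * (rate alpha beta (word s) (word r) - alpha * sigma_tens R n r s)
  + (c && ~~ b)%:R * sigma_tens R n r s
  + alpha * (c != b)%:R * (r == s)%:R.
Proof.
rewrite rateS !word_head !word_behead flip_head_word -sigma_tens_word.
by rewrite -(mulnb (c != b)) natrM mulrA [s == r]eq_sym.
Qed.

(** [N] drops the boundary flips of the tail but keeps their loss [- alpha] on the diagonal, which
    now accounts for flips of the new first site. An occupied first site adds a loss of 1, since
    exactly one bulk move on the first bond is then possible. *)
Lemma markov_matrixS n (M := markov_matrix alpha beta n.+1)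
    (S := sigma_tens R n) (N := M - alpha *: S) :
  markov_matrix alpha beta n.+2 =
  block2 N (S + alpha%:M) alpha%:M (N - 1%:M).
Proof.
apply: block2P => b c r s.
have sumD : \sum_(k < 2 ^ n.+1) ((k == s)%:R : R) = 1.
  by rewrite (bigD1 s) //= big1 => [|i /negPf ->]; rewrite ?eqxx ?addr0.
(* Total rate to the targets whose first site is in state [d]; over both [d] the terms in [alpha]
   cancel. *)
have sumE d : \sum_r rate alpha beta (word (cons_index c s)) (word (cons_index d r)) =
    (c == d)%:R * (\sum_r rate alpha beta (word s) (word r) - alpha)
    + (c && ~~ d)%:R + alpha * (c != d)%:R.
  under eq_bigr do rewrite rate_cons.
  rewrite 2!big_split /= -!mulr_sumr sumrB -mulr_sumr.
  by rewrite sum_sigma_tens sumD !mulr1.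
rewrite markov_matrixE block2E rate_cons sum_cons_index !sumE cons_index_eq.
have scalarE (a : R) : (a%:M : 'M_(2 ^ n.+1)) r s = a * (r == s)%:R.
  by rewrite mxE mulr_natr.
by case: b c {sumE} => [] [] /=; rewrite !(mx_linE, scalarE) ?markov_matrixE; ring.
Qed.

End Generator.

(** * Intertwining and nonvanishing *)

Section Transfer.
Context {R : realFieldType} (alpha beta : R).

Let M n := markov_matrix alpha beta n.+1.
Let S n := sigma_tens R n.
Let N n := M n - alpha *: S n.

(** Lets the case of one site go through the block calculus, with blocks of size 1 that are
    scalars. *)
Lemma mx2_block2 (a b c d : R) :
  mx2 a b c d = block2 (n := 0) a%:M b%:M c%:M d%:M :> 'M_(2 ^ 1).
Proof.
apply: (@block2P _ 0) => e f r s; rewrite block2E mxE (ord1 r) (ord1 s).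
by case: e f => [] []; rewrite !mxE.
Qed.

Lemma rate1 (x y : config 1) :
  rate alpha beta x y =
    alpha * (x ord0 != y ord0)%:R + beta * (x ord0 && ~~ y ord0)%:R.
Proof.
rewrite /rate left_rateE /bulk_rate big_ord1 big1 => [|j]; last by rewrite (ord1 j).
rewrite add0r /right_rate big_mkcond big_ord1 eqxx step1_head /flip_head.
have -> : behead_config x == behead_config y by apply/eqP/ffunP => - [].
by case: (x ord0) (y ord0) => [] [].
Qed.

Lemma markov_matrix1 :
  M 0 = mx2 (- alpha) (alpha + beta) alpha (- alpha - beta).
Proof.
rewrite mx2_block2; apply: block2P => b c r s; rewrite block2E (ord1 r) (ord1 s).
rewrite /M markov_matrixE sum_cons_index !big_ord1 cons_index_eq !rate1 !word_head.
by case: b c => [] []; rewrite /= !mxE /=; ring.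
Qed.

Lemma T_blocksS n (T := T_blocks alpha beta n) :
  T_blocks alpha beta n.+1 =
  (block2 (T.1 + alpha^-1 *: T.2)
          (2 *: T.2 + alpha^-1 *: (T.2 *m S n))
          T.2
          (alpha^-1 *: T.2),
   block2 (2 *: T.2) (T.2 *m S n) 0 T.2).
Proof. by rewrite /T /=; case: (T_blocks alpha beta n). Qed.


(** Subtracting [alpha *: S] cancels the two blocks [alpha%:M], so [N] becomes block upper
    triangular. *)
Lemma markov_matrixS_sub n : N n.+1 = block2 (N n) (S n) 0 (N n - 1%:M).
Proof.
rewrite /N /M markov_matrixS /S [sigma_tens R n.+1]sigma_tensE.
by rewrite scale_block2 sub_block2 !scaler0 !subr0 scale_scalar_mx mulr1 addrK subrr.
Qed.

Definition mul_mx_linE := (@mulmxDl R, @mulmxDr R, @mulmxN R, @mulNmx R,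
  @mulmx0 R, @mul0mx R, @mul_mx_scalar R, @mul_scalar_mx R,
  fun m n p a A B => esym (@scalemxAl R m n p a A B),
  fun m n p a A B => esym (@scalemxAr R m n p a A B), @mulmxA R).

Lemma T_blocks_invariant n (T := T_blocks alpha beta n) : alpha != 0 ->
  [/\ T.1 = T.2 *m (S n + alpha^-1%:M),
      T.2 *m N n = N n *m T.2 &
      S n *m T.2 = T.2 *m (S n + S n *m N n - N n *m S n)].
Proof.
move=> alpha_neq0; rewrite {}/T; elim: n => [|n].
  rewrite /N /S sigma_tensE markov_matrix1 /= !mx2_block2 scalar_block2.
  rewrite !(@scale_block2 R, @sub_block2 R, @add_block2 R, @mul_block2 R).
  (* Zero blocks are written as scalar matrices too, so that every block equation becomes one in
     [R]. *)
  rewrite -(raddf0 (@scalar_mx R (2 ^ 0))) !scale_scalar_mx.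
  rewrite -!(scalar_mxM, raddfD, raddfN, raddfB) /=.
  by split; congr block2; congr _%:M; field.
rewrite T_blocksS markov_matrixS_sub /=.
have := @sigma_tens_mulK R n; rewrite -/(S n).
have -> : S n.+1 = block2 0 1%:M 1%:M 0 by rewrite /S sigma_tensE.
case: (T_blocks _ _ n) => a b /=; move: (S n) (N n) => S' N'.
(* What remains are identities in noncommuting [b], [S'], [N']. The upper right block of the
   commutation reads [b S' + b S' N' = N' b S' + S' b], which is where [Sb] enters. *)
move=> SS [-> bN Sb]; have mulSS X : X *m S' *m S' = X :> 'M_(2 ^ n.+1).
  by rewrite -mulmxA SS mulmx1.
rewrite !mul_mx_linE in Sb.
rewrite (@scalar_block2 R n.+1) !(@sub_block2 R, @add_block2 R, @mul_block2 R).
(* Products are expanded and associated to the left, then [bN] and [Sb] move [b] to the front; the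
   rest is linear and is checked entrywise. *)
split; congr block2; rewrite !mul_mx_linE ?SS ?mulSS -?bN ?Sb ?mulSS;
  by apply/matrixP => i j; rewrite !mx_linE; field.
Qed.

(** The lower right block of [T_2] is the previous [T_2], down to the entry [alpha] for one site. *)
Lemma T_blocks2_neq0 n : alpha != 0 -> (T_blocks alpha beta n).2 != 0.
Proof.
move=> alpha_neq0; elim: n => [|n /eqP IHn]; apply/eqP.
  rewrite /= mx2_block2 => /block2_eq0[_ _ _ /matrixP/(_ ord0 ord0)].
  by rewrite !mxE => /eqP; apply/negP.
by rewrite T_blocksS => /block2_eq0[_ _ _].
Qed.

Lemma T_blocks2_markov_neq0 n : alpha != 0 -> (T_blocks alpha beta n).2 *m M n != 0.
Proof.
move=> alpha_neq0; apply/eqP; case: n => [|n].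
  (* For one site the lower left entry of the product is [alpha * alpha]. *)
  rewrite markov_matrix1 /= !mx2_block2 mul_block2.
  case/block2_eq0 => _ _ /matrixP/(_ ord0 ord0) + _.
  rewrite -!scalar_mxM -raddfD /= !mxE mul0r add0r => /eqP.
  by rewrite mulf_eq0 orbb (negPf alpha_neq0).
rewrite /M markov_matrixS T_blocksS /= mul_block2 => /block2_eq0[_ _ + _].
rewrite mul0mx add0r mul_mx_scalar => /eqP.
by rewrite scaler_eq0 (negPf alpha_neq0) (negPf (T_blocks2_neq0 n _)).
Qed.

Lemma transfer_matrix_mul n (X : 'M_(2 ^ n.+1)) (T := T_blocks alpha beta n) :
  transfer_matrix alpha beta n.+1 *m X =
  castmx (pow2D n.+1, erefl) (col_mx (T.1 *m X) (T.2 *m X)).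
Proof.
rewrite /T /transfer_matrix; case: (T_blocks _ _ n) => a b /=.
by rewrite -mul_col_mx; case: _ / (pow2D n.+1); rewrite !castmx_id.
Qed.

(** The lower row, [alpha T_1 + (N - 1) T_2 = T_2 M], follows from the formula for [T_1] and the
    commutation. In the upper row both sides become [T_2 (S N + S + N / alpha + alpha)], by the
    exchange rule for [S T_2]. *)
Lemma markov_transferC n : alpha != 0 ->
  M n.+1 *m transfer_matrix alpha beta n.+1 =
  transfer_matrix alpha beta n.+1 *m M n.
Proof.
move=> alpha_neq0; have [] := T_blocks_invariant n alpha_neq0.
have := @sigma_tens_mulK R n; rewrite -/(S n) transfer_matrix_mul.
have -> : M n = N n + alpha *: S n by rewrite subrK.
rewrite /M markov_matrixS -/(M n) -/(S n) -/(N n) /transfer_matrix.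
case: (T_blocks _ _ n) => a b /=; rewrite mul_block2_col.
move: (S n) (N n) => S' N' SS -> bN Sb.
have mulSS X : X *m S' *m S' = X :> 'M_(2 ^ n.+1).
  by rewrite -mulmxA SS mulmx1.
rewrite !mul_mx_linE in Sb.
congr (castmx _ (col_mx _ _)); rewrite !mul_mx_linE ?SS ?mulSS -?bN ?Sb ?mulSS;
  by apply/matrixP => i j; rewrite !mx_linE; field.
Qed.

End Transfer.

Theorem theorem2 (R : realFieldType) (alpha beta : R)
  (alpha_gt0 : 0 < alpha) (beta_gt0 : 0 < beta) :
  transfer_matrix_family (markov_matrix alpha beta) (transfer_matrix alpha beta).
Proof.
have alpha_neq0 := lt0r_neq0 alpha_gt0; case=> // n _.
(* By the intertwining it suffices that the lower half [T_2 M] of the other product is nonzero. *)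
rewrite markov_transferC //; split=> //; rewrite transfer_matrix_mul.
move/eqP; rewrite castmx_eq0 col_mx_eq0 => /andP[_].
by rewrite (negPf (T_blocks2_markov_neq0 _ _ n _)).
Qed.
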